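(* Let $0\le\mu<L\le+\infty$, $N\ge1$, $R\ge 0$, let $H=\{h_{i,k}\}$ define a fixed-step method with $N$ steps, and let $b\in\mathbb{R}^{N+1}$, $C\in\mathbb{S}^{N+2}$. If $d\ge N+2$, then $w^{(d)}_{\mu,L}(R,H,N,b,C)=w^{sdp}_{\mu,L}(R,H,N,b,C)$; that is, the worst-case performance after $N$ iterations of the method $H$, measured by the criterion $b^{\top}f+\mathrm{Tr}(CG)$, over functions in $\mathcal{F}_{\mu,L}(\mathbb{R}^d)$ equals the optimal value of the semidefinite program defining $w^{sdp}_{\mu,L}$.
   Context: Conventions: $1/(+\infty)=0$, $+\infty-\mu=+\infty$. For $\mu\ge0$, $L\in\mathbb{R}_+\cup\{+\infty\}$, $\mu<L$, $\mathcal{F}_{\mu,L}(\mathbb{R}^d)$ is the set of proper closed convex $f:\mathbb{R}^d\to\mathbb{R}\cup\{+\infty\}$ with (i) $\frac1L\|g_1-g_2\|_2\le\|x_1-x_2\|_2$ for all $x_1,x_2$ and all $g_1\in\partial f(x_1)$, $g_2\in\partial f(x_2)$, and (ii) $f-\frac\mu2\|\cdot\|_2^2$ convex. A set $\{(x_i,g_i,f_i)\}_{i\in I}$ is $\mathcal{F}_{\mu,L}$-interpolable if some $f\in\mathcal{F}_{\mu,L}(\mathbb{R}^d)$ has $f(x_i)=f_i$, $g_i\in\partial f(x_i)$ for all $i\in I$. Fixed-step method with $N$ steps: scalars $h_{i,k}$ for $1\le i\le N$, $0\le k\le N-1$, with $h_{i,k}=0$ for $k\ge i$ (a lower-triangular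 $H\in\mathbb{R}^{N\times N}$); starting from $x_0$, iterates are $x_i=x_0-\sum_{k=0}^{i-1}h_{i,k}g_k$, where $g_k$ is the (sub)gradient returned by the first-order oracle at $x_k$. Let $I=\{0,1,\dots,N,*\}$. The quantity $w^{(d)}_{\mu,L}(R,H,N,b,C)$ is the supremum of $b^{\top}(f_0,\dots,f_N)^{\top}+\mathrm{Tr}(CG)$ over all collections $\{(x_i,g_i,f_i)\}_{i\in I}\subset\mathbb{R}^d\times\mathbb{R}^d\times\mathbb{R}$ such that: the collection is $\mathcal{F}_{\mu,L}$-interpolable; $(x_*,g_*,f_* )=(0,0,0)$; $x_i=x_0-\sum_{k=0}^{i-1}h_{i,k}g_k$ for $i=1,\dots,N$; and $\|x_0-x_*\|_2\le R$. Here $G=P^{\top}P\in\mathbb{S}^{N+2}$ with $P=[g_0\ g_1\ \cdots\ g_N\ x_0]\in\mathbb{R}^{d\times(N+2)}$. (Thus $x_*$ is a minimizer with optimal value $0$, and $w^{(d)}$ is the worst case of the criterion over $\mathcal{F}_{\mu,L}(\mathbb{R}^d)$ and starting points within distance $R$ of a minimizer.) Semidefinite program: let $e_1,\dots,e_{N+2}$ be the standard basis of $\mathbb{R}^{N+2}$. For $i=0,\dots,N$ let $h_i=(-h_{i,0},\dots,-h_{i,i-1},0,\dots,0,1)^{\top}\in\mathbb{R}^{N+2}$ (last entry $1$) and $u_i=e_{i+1}$; let $h_*=u_*=0$. For $i,j\in I$ define the symmetric matrix $A_{ij}$ by $2A_{ij}=\frac{L}{L-\mu}\big(u_j(h_i-h_j)^{\top}+(h_i-h_j)u_j^{\top}\big)+\frac{1}{L-\mu}(u_i-u_j)(u_i-u_j)^{\top}+\frac{\mu}{L-\mu}\big(u_i(h_j-h_i)^{\top}+(h_j-h_i)u_i^{\top}\big)+\frac{L\mu}{L-\mu}(h_i-h_j)(h_i-h_j)^{\top}$,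 where for $L=+\infty$ the coefficients are taken as $\frac{L}{L-\mu}=1$, $\frac{1}{L-\mu}=0$, $\frac{\mu}{L-\mu}=0$, $\frac{L\mu}{L-\mu}=\mu$; and $A_R=e_{N+2}e_{N+2}^{\top}$. Then $w^{sdp}_{\mu,L}(R,H,N,b,C)$ is the supremum of $b^{\top}f+\mathrm{Tr}(CG)$ over $G\in\mathbb{S}^{N+2}$, $f=(f_0,\dots,f_N)\in\mathbb{R}^{N+1}$ subject to $f_j-f_i+\mathrm{Tr}(GA_{ij})\le0$ for all $i,j\in I$ (with $f_*:=0$), $\mathrm{Tr}(GA_R)\le R^2$, and $G\succeq0$. *)

(* Defs.v *)
From HB Require Import structures.
From mathcomp Require Import all_boot all_order all_algebra.
From mathcomp Require Import boolp classical_sets reals constructive_ereal ereal.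
Set Implicit Arguments. Unset Strict Implicit. Unset Printing Implicit Defensive.
Import Order.TTheory GRing.Theory Num.Theory.
Local Open Scope ring_scope.

Section Defs.
Variable R : realType.

Definition dotp (d : nat) (u v : 'rV[R]_d) : R := \sum_(k < d) u 0 k * v 0 k.
Definition norm2 (d : nat) (u : 'rV[R]_d) : R := Num.sqrt (dotp u u).

Definition proper_fun (d : nat) (f : 'rV[R]_d -> \bar R) : Prop :=
  (forall x, f x != -oo%E) /\ (exists x, f x \is a fin_num).

Definition lsc_fun (d : nat) (f : 'rV[R]_d -> \bar R) : Prop :=
  forall x (a : R), (a%:E < f x)%E ->
    exists2 e : R, 0 < e & forall y, norm2 (y - x) < e -> (a%:E < f y)%E.

Definition convex_fun (d : nat) (f : 'rV[R]_d -> \bar R) : Prop :=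
  forall x y : 'rV[R]_d, forall t : R, 0 < t -> t < 1 ->
    (f (t *: x + (1 - t) *: y)%R <= t%:E * f x + (1 - t)%:E * f y)%E.

Definition subgrad (d : nat) (f : 'rV[R]_d -> \bar R) (x g : 'rV[R]_d) : Prop :=
  f x \is a fin_num /\
  forall y, ((fine (f x) + dotp g (y - x))%:E <= f y)%E.

Definition invL (L : \bar R) : R :=
  match L with EFin l => l^-1 | _ => 0 end.

Definition F_muL (mu : R) (L : \bar R) (d : nat) (f : 'rV[R]_d -> \bar R) : Prop :=
  [/\ proper_fun f, lsc_fun f, convex_fun f,
      (forall x1 x2 g1 g2, subgrad f x1 g1 -> subgrad f x2 g2 ->
          invL L * norm2 (g1 - g2) <= norm2 (x1 - x2)) &
      convex_fun (fun x => f x - (mu / 2 * norm2 x ^+ 2)%:E)%E].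

(* index set I = {0,...,N,*} : Some i <-> i, None <-> * *)
Definition idx (N : nat) := option 'I_N.+1.

Definition interpolable (mu : R) (L : \bar R) (d N : nat)
    (x g : idx N -> 'rV[R]_d) (fv : idx N -> R) : Prop :=
  exists f : 'rV[R]_d -> \bar R,
    F_muL mu L f /\ forall i, f (x i) = (fv i)%:E /\ subgrad f (x i) (g i).

Definition Pmat (d N : nat) (x g : idx N -> 'rV[R]_d) : 'M[R]_(d, N.+2) :=
  \matrix_(k < d, j < N.+2)
     (if (j < N.+1)%N then g (Some (inord j)) 0 k else x (Some ord0) 0 k).

Definition Gram (d N : nat) (x g : idx N -> 'rV[R]_d) : 'M[R]_N.+2 :=
  (Pmat x g)^T *m Pmat x g.

Definition lower_tri (N : nat) (h : nat -> nat -> R) : Prop :=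
  forall i k, (1 <= i <= N)%N -> (i <= k)%N -> h i k = 0.

Definition wd_feasible (mu : R) (L : \bar R) (Rad : R) (h : nat -> nat -> R)
    (d N : nat) (x g : idx N -> 'rV[R]_d) (fv : idx N -> R) : Prop :=
  [/\ interpolable mu L x g fv,
      x None = 0 /\ g None = 0 /\ fv None = 0,
      (forall i : 'I_N.+1, (1 <= i)%N ->
          x (Some i) = x (Some ord0) - \sum_(k < N.+1 | (k < i)%N) h i k *: g (Some k)) &
      norm2 (x (Some ord0) - x None) <= Rad].

Definition objective (N : nat) (b : 'cV[R]_N.+1) (C : 'M[R]_N.+2)
    (fv : 'I_N.+1 -> R) (G : 'M[R]_N.+2) : R :=
  \sum_(i < N.+1) b i 0 * fv i + \tr (C *m G).

Definition w_d (mu : R) (L : \bar R) (Rad : R) (h : nat -> nat -> R) (N : nat)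
    (b : 'cV[R]_N.+1) (C : 'M[R]_N.+2) (d : nat) : \bar R :=
  ereal_sup [set v : \bar R | exists (x g : idx N -> 'rV[R]_d) (fv : idx N -> R),
     wd_feasible mu L Rad h x g fv /\
     v = (objective b C (fun i => fv (Some i)) (Gram x g))%:E].

Definition psd (n : nat) (G : 'M[R]_n) : Prop :=
  G^T = G /\ forall v : 'rV[R]_n, 0 <= (v *m G *m v^T) 0 0.

Definition ebas (N : nat) (j : 'I_N.+2) : 'cV[R]_N.+2 :=
  \col_(k < N.+2) (if k == j then 1 else 0).

Definition hvec (N : nat) (h : nat -> nat -> R) (i : idx N) : 'cV[R]_N.+2 :=
  match i with
  | None => 0
  | Some i => \col_(k < N.+2)
      (if (k < N.+1)%N then (if (k < i)%N then - h i k else 0) else 1)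
  end.

Definition uvec (N : nat) (i : idx N) : 'cV[R]_N.+2 :=
  match i with
  | None => 0
  | Some i => ebas (widen_ord (leqnSn N.+1) i)
  end.

Definition cL (mu : R) (L : \bar R) : R :=
  match L with EFin l => l / (l - mu) | _ => 1 end.
Definition c1 (mu : R) (L : \bar R) : R :=
  match L with EFin l => 1 / (l - mu) | _ => 0 end.
Definition cmu (mu : R) (L : \bar R) : R :=
  match L with EFin l => mu / (l - mu) | _ => 0 end.
Definition cLmu (mu : R) (L : \bar R) : R :=
  match L with EFin l => l * mu / (l - mu) | _ => mu end.

Definition Amat (mu : R) (L : \bar R) (N : nat) (h : nat -> nat -> R)
    (i j : idx N) : 'M[R]_N.+2 :=
  let hi := hvec h i in let hj := hvec h j in
  let ui := uvec i in let uj := uvec j in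
  2^-1 *: (cL mu L *: (uj *m (hi - hj)^T + (hi - hj) *m uj^T)
         + c1 mu L *: ((ui - uj) *m (ui - uj)^T)
         + cmu mu L *: (ui *m (hj - hi)^T + (hj - hi) *m ui^T)
         + cLmu mu L *: ((hi - hj) *m (hi - hj)^T)).

Definition AR (N : nat) : 'M[R]_N.+2 := ebas ord_max *m (ebas ord_max)^T.

Definition fext (N : nat) (f : 'cV[R]_N.+1) (i : idx N) : R :=
  match i with None => 0 | Some i => f i 0 end.

Definition sdp_feasible (mu : R) (L : \bar R) (Rad : R) (h : nat -> nat -> R)
    (N : nat) (G : 'M[R]_N.+2) (f : 'cV[R]_N.+1) : Prop :=
  [/\ forall i j : idx N,
        fext f j - fext f i + \tr (G *m Amat mu L h i j) <= 0,
      \tr (G *m AR N) <= Rad ^+ 2 & psd G].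

Definition w_sdp (mu : R) (L : \bar R) (Rad : R) (h : nat -> nat -> R) (N : nat)
    (b : 'cV[R]_N.+1) (C : 'M[R]_N.+2) : \bar R :=
  ereal_sup [set v : \bar R | exists (G : 'M[R]_N.+2) (f : 'cV[R]_N.+1),
     sdp_feasible mu L Rad h G f /\ v = (objective b C (fun i => f i 0) G)%:E].

End Defs.

(* Main.v *)
Require Import Defs.
From HB Require Import structures.
From mathcomp Require Import all_boot all_order all_algebra.
From mathcomp Require Import boolp classical_sets reals constructive_ereal ereal.
From mathcomp Require Import ring lra.
Import Order.TTheory GRing.Theory Num.Theory.
Local Open Scope ring_scope.
Set Implicit Arguments.
Unset Strict Implicit.

(* The two suprema range over the same set of values. Writing the Gram matrix
   as G = P^T P, the SDP constraints say exactly that every pair of triples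
   (x_i, g_i, f_i), (x_j, g_j, f_j) satisfies the interpolation inequality,
   so the point is that these inequalities characterize interpolability
   (d >= N + 2 is what lets every PSD matrix of size N + 2 be such a Gram
   matrix). After subtracting mu/2 |.|^2 the inequality reads, with
   Lam = L - mu,
     f_i >= f_j + <g_j, x_i - x_j> + |g_i - g_j|^2 / (2 Lam).

   Necessity: implicit gradient steps always exist for a closed convex
   function, so no regularity of the domain is needed. A step of length gam
   on f - <g_j, .> decreases it by at least gam |g' - g_j|^2, and by Lipschitz
   continuity |g - g_j| <= (1 + Lam gam) |g' - g_j|; hence the best constant s
   in f_i - f_j - <g_j, x_i - x_j> >= s |g_i - g_j|^2 is at least 1 / (2 Lam).
   This is applied to f itself with constant L, which yields cocoercivity, and
   then, using cocoercivity, to f - mu/2 |.|^2 with constant L - mu.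

   Sufficiency: an interpolating function is mu/2 |.|^2 plus the Moreau
   envelope with parameter 1 / Lam of a maximum of affine functions (for
   L = +oo, plus the maximum itself). *)

(** * Euclidean inner product, Young and Cauchy-Schwarz inequalities *)

Section InnerProduct.
Variables (R : realType) (d : nat).
Implicit Types (u v w : 'rV[R]_d) (a b : R).

Definition sqn u : R := dotp u u.

Lemma dotpC u v : dotp u v = dotp v u.
Proof. by apply: eq_bigr => k _; rewrite mulrC. Qed.

Lemma dotpDl u v w : dotp (u + v) w = dotp u w + dotp v w.
Proof. by rewrite -big_split; apply: eq_bigr => k _; rewrite mxE mulrDl. Qed.

Lemma dotpZl a u v : dotp (a *: u) v = a * dotp u v.
Proof. by rewrite mulr_sumr; apply: eq_bigr => k _; rewrite mxE mulrA. Qed.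

Lemma dotpNl u v : dotp (- u) v = - dotp u v.
Proof. by rewrite -scaleN1r dotpZl mulN1r. Qed.

Lemma dotpDr u v w : dotp u (v + w) = dotp u v + dotp u w.
Proof. by rewrite dotpC dotpDl !(dotpC _ u). Qed.

Lemma dotpZr a u v : dotp u (a *: v) = a * dotp u v.
Proof. by rewrite dotpC dotpZl dotpC. Qed.

Lemma dotpNr u v : dotp u (- v) = - dotp u v.
Proof. by rewrite dotpC dotpNl dotpC. Qed.

Lemma dotp0l v : dotp 0 v = 0.
Proof. by rewrite -(scale0r 0) dotpZl mul0r. Qed.

Definition dotpE := (dotpDl, dotpDr, dotpNl, dotpNr, dotpZl, dotpZr).

Lemma sqn_ge0 u : 0 <= sqn u.
Proof. by apply: sumr_ge0 => k _; rewrite -expr2 sqr_ge0. Qed.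

Lemma sqnZ a u : sqn (a *: u) = a ^+ 2 * sqn u.
Proof. by rewrite /sqn dotpZl dotpZr; ring. Qed.

Lemma sqnN u : sqn (- u) = sqn u.
Proof. by rewrite /sqn dotpNl dotpNr opprK. Qed.

Lemma sqnB u v : sqn (u - v) = sqn (v - u).
Proof. by rewrite -sqnN opprB. Qed.

Lemma sqn_eq0 u : sqn u = 0 -> u = 0.
Proof.
move=> /eqP; rewrite /sqn /dotp psumr_eq0; last first.
  by move=> k _; rewrite -expr2 sqr_ge0.
move=> /allP h; apply/rowP => k; rewrite mxE.
by have := h k (mem_index_enum k); rewrite -expr2 sqrf_eq0 => /eqP.
Qed.

Lemma sqr_coord_le u k : u 0 k ^+ 2 <= sqn u.
Proof.
rewrite /sqn /dotp (bigD1 k) //= -expr2 lerDl.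
by apply: sumr_ge0 => i _; rewrite -expr2 sqr_ge0.
Qed.

Lemma norm2_sqr u : norm2 u ^+ 2 = sqn u.
Proof. by rewrite sqr_sqrtr // sqn_ge0. Qed.

Lemma norm2_ge0 u : 0 <= norm2 u.
Proof. exact: sqrtr_ge0. Qed.

Lemma young u v a : 0 < a -> 2 * dotp u v <= a * sqn u + a^-1 * sqn v.
Proof.
move=> a0; have := sqn_ge0 (a *: u - v).
rewrite /sqn !dotpE (dotpC v u) => H.
have ai0 : 0 <= a^-1 by rewrite invr_ge0 ltW.
have {}H := mulr_ge0 ai0 H.
rewrite -subr_ge0; apply: le_trans H _.
by rewrite le_eqVlt; apply/orP; left; apply/eqP; field; rewrite gt_eqF.
Qed.

Lemma cauchy_schwarz_sqr u v : dotp u v ^+ 2 <= sqn u * sqn v.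
Proof.
have [/sqn_eq0 -> | u0] := eqVneq (sqn u) 0.
  by rewrite dotp0l /sqn dotp0l mul0r expr0n.
have {}u0 : 0 < sqn u by rewrite lt_def u0 sqn_ge0.
have := sqn_ge0 (sqn u *: v - dotp u v *: u).
rewrite {1}/sqn !dotpE (dotpC v u) -!/(sqn _) => H.
rewrite -subr_ge0 -(pmulr_rge0 _ u0); apply: le_trans H _.
by rewrite le_eqVlt; apply/orP; left; apply/eqP; ring.
Qed.

Lemma dotp_le_norm2 u v : dotp u v <= norm2 u * norm2 v.
Proof.
have [h|/ltW h] := leP (dotp u v) 0.
  by apply: le_trans h _; rewrite mulr_ge0 ?norm2_ge0.
rewrite -(ler_sqr h) ?nnegrE ?mulr_ge0 ?norm2_ge0 //.
by rewrite exprMn !norm2_sqr cauchy_schwarz_sqr.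
Qed.

End InnerProduct.


Ltac vring := apply/rowP => ?; rewrite !mxE; ring.

(** Dividing by [t] and letting it tend to 0: this turns an inequality along a segment into a
    first-order condition. *)
Lemma linear_coef_ge0 (R : realFieldType) (a b : R) :
  (forall t, 0 < t -> t < 1 -> 0 <= t * a + t ^+ 2 * b) -> 0 <= a.
Proof.
move=> H; rewrite leNgt; apply/negP => a0.
(* This choice gives t |b| < - a / 2, so [a + t * b] stays negative. *)
pose t := - a / (`|b| - a + 1) / 2.
have D0 : 0 < `|b| - a + 1 by have := normr_ge0 b; lra.
have t0 : 0 < t by rewrite /t !divr_gt0 //; lra.
have tD : t * (`|b| - a + 1) = - a / 2 by rewrite /t; field; rewrite gt_eqF.
have t1 : t < 1.
  by rewrite /t; rewrite ltr_pdivrMr // ltr_pdivrMr //; have := normr_ge0 b; lra.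
have := H t t0 t1; rewrite expr2 -mulrA -mulrDr pmulr_rge0 //.
have : t * b <= t * `|b| by rewrite ler_pM2l // ler_norm.
have : 0 < t * (1 - a) by rewrite mulr_gt0 //; lra.
lra.
Qed.

(** * Quantitative completeness of the reals and of R^d *)

Section Cauchy.
Variable R : realType.

(* The limit is the supremum of the lower ends of the nested intervals
   [u n - e n, u n + e n]. *)
Lemma cauchy_real (u e : nat -> R) :
  (forall n m, (n <= m)%N -> `|u n - u m| <= e n) ->
  exists l, forall n, `|u n - l| <= e n.
Proof.
move=> H.
have e0 n : 0 <= e n by apply: le_trans (H n n _).
have lb n m : u n - e n <= u m + e m.
  have [nm|/ltnW mn] := leqP n m.
    by have := H _ _ nm; have := e0 m; rewrite ler_norml => ? /andP[? ?]; lra.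
  by have := H _ _ mn; have := e0 n; rewrite ler_norml => ? /andP[? ?]; lra.
pose S : set R := [set v | exists n, v = u n - e n]%classic.
exists (sup S) => n; rewrite ler_norml; apply/andP; split.
  rewrite lerBrDr addrC lerBlDr addrC; apply: ge_sup; first by exists (u 0%N - e 0%N), 0%N.
  by move=> _ [m ->]; rewrite addrC.
suff : u n - e n <= sup S by lra.
apply: ub_le_sup; last by exists n.
by exists (u n + e n) => _ [m ->].
Qed.

(** Limits are taken coordinatewise; the factor [d] comes from summing the coordinate errors. *)
Lemma cauchy_vector d (u : nat -> 'rV[R]_d) (e : nat -> R) :
  (forall n, 0 <= e n) ->
  (forall n m, (n <= m)%N -> sqn (u n - u m) <= e n ^+ 2) ->
  exists l, forall n, sqn (u n - l) <= d%:R * e n ^+ 2.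
Proof.
move=> e0 H.
have /choice[l Hl] (k : 'I_d) : exists l, forall n, `|u n 0 k - l| <= e n.
  apply: cauchy_real => n m nm.
  rewrite -(ler_sqr _ (e0 n)) ?nnegrE ?normr_ge0 // real_normK ?num_real //.
  apply: le_trans (H n m nm).
  by have := sqr_coord_le (u n - u m) k; rewrite !mxE.
exists (\row_k l k) => n; rewrite /sqn /dotp.
apply: le_trans (_ : \sum_(k < d) e n ^+ 2 <= _); last first.
  by rewrite sumr_const card_ord mulr_natl.
apply: ler_sum => k _; rewrite !mxE -expr2 -real_normK ?num_real //.
by rewrite ler_sqr ?nnegrE ?normr_ge0.
Qed.

End Cauchy.

(** * Proximal points of closed convex functions *)

Section Epigraph.
Variables (R : realType) (d : nat).
Implicit Types (E : 'rV[R]_d -> R -> Prop) (x y z g p : 'rV[R]_d).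

(** A function is represented by its epigraph, [E x r] meaning that its value at [x] is at most [r];
    this avoids arithmetic with infinite values. *)
Definition convex_epi E := forall x y (r s t : R), 0 < t -> t < 1 ->
  E x r -> E y s -> E (t *: x + (1 - t) *: y) (t * r + (1 - t) * s).

(** The one-sided bound [s < r + e] also makes [E x] upward closed. *)
Definition closed_epi E := forall x r,
  (forall e : R, 0 < e -> exists y s, [/\ E y s, sqn (y - x) < e & s < r + e]) ->
  E x r.

(** Taking [y = x] shows that [c] is the least [r] with [E x r], hence the value at [x]. *)
Definition subgrad_epi E x c g :=
  E x c /\ forall y r, E y r -> c + dotp g (y - x) <= r.

(** The point [p] minimizes [r + k * sqn (p - z)] over the epigraph: the parallelogram identity
    makes a minimizing sequence Cauchy, and first-order optimality at the limit gives the
    subgradient. *)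
Lemma prox_exists E x0 c0 g0 z k : convex_epi E -> closed_epi E ->
  subgrad_epi E x0 c0 g0 -> 0 < k ->
  exists p c, subgrad_epi E p c ((2 * k) *: (z - p)).
Proof.
move=> cE clE [E0 sub0] k0.
pose S : set R := [set v | exists p r, E p r /\ v = r + k * sqn (p - z)]%classic.
have Slb : has_lbound S.
  (* Young's inequality with weight 1 / (2 k) absorbs the linear part of the affine minorant into
     the quadratic. *)
  exists (c0 + dotp g0 (z - x0) - (4 * k)^-1 * sqn g0) => _ [p [r [Er ->]]].
  have h := sub0 _ _ Er.
  have := @young _ _ (- g0) (p - z) (2 * k)^-1; rewrite invr_gt0 mulr_gt0 //.
  move=> /(_ isT); rewrite sqnN invrK dotpNl.
  move: h; have -> : p - x0 = (p - z) + (z - x0) by rewrite addrA subrK.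
  rewrite dotpDr.
  have -> : (2 * k)^-1 = 2 * (4 * k)^-1 by field; rewrite gt_eqF.
  lra.
have S0 : has_inf S by split => //; exists (c0 + k * sqn (x0 - z)), x0, c0.
set m := inf S.
have mle p r : E p r -> m <= r + k * sqn (p - z).
  by move=> Er; apply: ge_inf => //; exists p, r.
pose q n : R := n.+1%:R^-1.
have q0 n : 0 < q n by rewrite invr_gt0 ltr0n.
have q1 n : q n <= 1 by rewrite invf_le1 ?ltr0n // ler1n.
(* The midpoint inequality below converts an excess of [k / 4 * q n ^+ 2] into a squared distance of
   at most [q n ^+ 2]. *)
have /choice[pr Hpr] n : exists pr : 'rV[R]_d * R,
    E pr.1 pr.2 /\ pr.2 + k * sqn (pr.1 - z) < m + k / 4 * q n ^+ 2.
  have [|_ [p [r [Er ->]]] lt] := @inf_adherent _ S (k / 4 * q n ^+ 2) _ S0.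
    by rewrite mulr_gt0 ?exprn_gt0 // divr_gt0.
  by exists (p, r).
have [||p Hp] := @cauchy_vector R d (fun n => (pr n).1) q.
- by move=> n; rewrite ltW.
- move=> n l nl; have [En ln] := Hpr n; have [El ll] := Hpr l.
  have h1 : (0 : R) < 1 / 2 by lra.
  have h2 : (1 : R) / 2 < 1 by lra.
  have /= mid := mle _ _ (cE _ _ _ _ _ h1 h2 En El).
  have ql : q l ^+ 2 <= q n ^+ 2.
    rewrite ler_sqr ?nnegrE ?(ltW (q0 _)) //.
    by rewrite /q lef_pV2 ?posrE ?ltr0n // ler_nat.
  have {}ql : k * q l ^+ 2 <= k * q n ^+ 2 by rewrite ler_pM2l.
  rewrite -(ler_pM2l k0) /=; move: mid.
  set a := (pr n).1 in En ln *; set b := (pr l).1 in El ll *.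
  have -> : sqn (1 / 2 *: a + (1 - 1 / 2) *: b - z) =
     1 / 2 * sqn (a - z) + 1 / 2 * sqn (b - z) - 1 / 4 * sqn (a - b).
    rewrite /sqn !dotpE (dotpC b a) (dotpC z a) (dotpC z b).
    by field.
  lra.
have Ep : E p (m - k * sqn (p - z)).
  apply: clE => e e0.
  (* [K] collects errors of order [q n]: [k / 4] from near-minimality, the next term from expanding
     the quadratic around [p], [d%:R] from the distance to [p]; the 1 ensures positivity. *)
  pose K := k / 4 + k * (sqn (p - z) + d%:R) + d%:R + 1.
  have K0 : 0 < K.
    have := mulr_ge0 (ltW k0) (addr_ge0 (sqn_ge0 (p - z)) (ler0n _ d)).
    by rewrite /K; have := ler0n R d; lra.
  have [n ] := @ltr_add_invr R 0 (e / K) (divr_gt0 e0 K0).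
  rewrite add0r -/(q n) ltr_pdivlMr // => qe.
  have [En ln] := Hpr n; exists (pr n).1, (pr n).2; split=> //.
    apply: le_lt_trans (Hp n) _; apply: le_lt_trans qe.
    rewrite expr2 mulrC -mulrA ler_pM2l //.
    apply: le_trans (_ : d%:R <= _); first by rewrite ler_piMl.
    rewrite /K; have := mulr_ge0 (ltW k0) (addr_ge0 (sqn_ge0 (p - z)) (ler0n _ d)).
    lra.
  have := Hp n; set w := _ - p => Hw.
  move: ln; have -> : (pr n).1 - z = w + (p - z) by rewrite /w addrA subrK.
  have yo := young (- (p - z)) w (q0 n).
  have : (q n)^-1 * sqn w <= d%:R * q n.
    rewrite mulrC ler_pdivrMr //; apply: le_trans Hw _.
    by rewrite -mulrA -expr2.
  move: yo; rewrite sqnN dotpNl => yo wq.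
  have -> : sqn (w + (p - z)) = sqn w + 2 * dotp (p - z) w + sqn (p - z).
    by rewrite /sqn (dotpDl w) 2!(dotpDr _ w) (dotpC w (p - z)); ring.
  have := sqn_ge0 w => w0.
  have := ler_pM2l k0 => kM.
  have {}yo : k * (- (2 * dotp (p - z) w)) <= k * (q n * (sqn (p - z) + d%:R)).
    rewrite kM; lra.
  have {}w0 : 0 <= k * sqn w by rewrite mulr_ge0 // ltW.
  have : k / 4 * q n ^+ 2 <= k / 4 * q n.
    by rewrite ler_pM2l ?divr_gt0 // expr2 ler_piMl // ltW.
  have : 0 <= q n * (d%:R + 1) by rewrite mulr_ge0 ?addr_ge0 // ltW.
  move: qe; rewrite /K; lra.
exists p, (m - k * sqn (p - z)); split=> // y r Er; rewrite -subr_ge0.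
(* The minimum is compared with the point at parameter [t] on the segment from [p] to [y]. *)
apply: (@linear_coef_ge0 _ _ (k * sqn (y - p))) => t t0 t1.
have := mle _ _ (cE _ _ _ _ _ t0 t1 Er Ep).
have -> : t *: y + (1 - t) *: p - z = t *: (y - p) - (z - p) by vring.
rewrite (sqnB p z) /sqn dotpZl !(dotpDl, dotpDr, dotpZl, dotpZr, dotpNl, dotpNr).
rewrite (dotpC y p) (dotpC y z) (dotpC p z).
lra.
Qed.
End Epigraph.

(** * Necessity of the interpolation inequalities *)

Section SmoothLowerBound.
Variables (R : realType) (d : nat).
Implicit Types (E : 'rV[R]_d -> R -> Prop) (x y z g p : 'rV[R]_d).

(* For an implicit gradient step x2 = x1 - gam * (g2 - g) on the function
   tilted by g, the gradient norm shrinks by at most the factor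
   1 + Lam * gam. *)
Definition implicit_step_bound E (Lam gam0 : R) :=
  forall (gam : R) x1 c1 g1 x2 c2 g2 g, 0 < gam -> gam < gam0 ->
  subgrad_epi E x1 c1 g1 -> subgrad_epi E x2 c2 g2 ->
  x1 - x2 = gam *: (g2 - g) ->
  sqn (g1 - g) <= (1 + Lam * gam) ^+ 2 * sqn (g2 - g).

(* The best constant s with s |g - gy|^2 <= f x - f y - <gy, x - y> satisfies
   gam + s <= s (1 + Lam gam)^2, because one implicit step decreases the
   right-hand side by gam |g' - gy|^2; let gam tend to 0. *)
Lemma smooth_lower_bound E (Lam gam0 : R) x cx gx y cy gy :
  convex_epi E -> closed_epi E -> 0 < Lam -> 0 < gam0 ->
  implicit_step_bound E Lam gam0 ->
  subgrad_epi E x cx gx -> subgrad_epi E y cy gy ->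
  cy + dotp gy (x - y) + (2 * Lam)^-1 * sqn (gx - gy) <= cx.
Proof.
move=> cE clE Lam0 gam00 step sx sy.
have gap z c g : subgrad_epi E z c g -> 0 <= c - cy - dotp gy (z - y).
  by move=> [Ez _]; have := sy.2 _ _ Ez; lra.
have [->|n0] := eqVneq (sqn (gx - gy)) 0; first by have := gap _ _ _ sx; lra.
have {}n0 : 0 < sqn (gx - gy) by rewrite lt_def n0 sqn_ge0.
pose K : set R := [set k | forall z c g, subgrad_epi E z c g ->
  k * sqn (g - gy) <= c - cy - dotp gy (z - y)]%classic.
have K0 : K 0 by move=> z c g /gap; rewrite mul0r.
have Kub : has_ubound K.
  exists ((cx - cy - dotp gy (x - y)) / sqn (gx - gy)) => k /(_ _ _ _ sx).
  by rewrite ler_pdivlMr.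
set s := sup K.
have s0 : 0 <= s by exact: ub_le_sup.
have Ks : K s.
  move=> z c g sz; have [->|m0] := eqVneq (sqn (g - gy)) 0.
    by rewrite mulr0; exact: gap sz.
  have {}m0 : 0 < sqn (g - gy) by rewrite lt_def m0 sqn_ge0.
  rewrite -ler_pdivlMr //; apply: ge_sup; first by exists 0.
  by move=> k /(_ _ _ _ sz); rewrite ler_pdivlMr.
have main gam : 0 < gam -> gam < gam0 -> gam + s <= s * (1 + Lam * gam) ^+ 2.
  move=> g0 g1.
  have D0 : 0 < (1 + Lam * gam) ^+ 2.
    by rewrite exprn_gt0 // addr_gt0 // mulr_gt0.
  rewrite -ler_pdivrMr //; apply: ub_le_sup => // z c g sz.
  have k0 : 0 < (2 * gam)^-1 by rewrite invr_gt0 mulr_gt0.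
  (* A proximal step centred at [z + gam *: gy] is the implicit step of length [gam] from [z] on the
     function tilted by [gy]. *)
  have [p [c' sp]] := prox_exists (z + gam *: gy) cE clE sx k0.
  set g' := _ *: _ in sp.
  have Hstep : z - p = gam *: (g' - gy).
    rewrite /g'; apply/rowP => i; rewrite !mxE; field; lra.
  have le := step _ _ _ _ _ _ _ _ g0 g1 sz sp Hstep.
  have := sp.2 _ _ sz.1; have := Ks _ _ _ sp.
  have -> : z - y = (z - p) + (p - y) by rewrite addrA subrK.
  rewrite (dotpDr gy (z - p)) Hstep !dotpZr => h1 h2.
  rewrite mulrAC ler_pdivrMr // [leRHS]mulrC.
  have e1 : dotp g' (g' - gy) = dotp gy (g' - gy) + sqn (g' - gy).
    by rewrite /sqn (dotpDl g') dotpNl; ring.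
  have : (gam + s) * sqn (g - gy) <=
         (gam + s) * ((1 + Lam * gam) ^+ 2 * sqn (g' - gy)).
    by rewrite ler_wpM2l // addr_ge0 // ltW.
  move/le_trans; apply.
  rewrite mulrCA ler_pM2l //; move: h2; rewrite e1; lra.
have : 0 <= 2 * Lam * s - 1.
  apply: (@linear_coef_ge0 _ _ (s * Lam ^+ 2 * gam0)) => t t0 t1.
  have tg : 0 < t * gam0 by rewrite mulr_gt0.
  have tg1 : t * gam0 < gam0 by rewrite -[ltRHS]mul1r ltr_pM2r.
  have h := main _ tg tg1.
  rewrite -(pmulr_rge0 _ gam00) -subr_ge0 in h *.
  by apply: le_trans h _; rewrite le_eqVlt; apply/orP; left; apply/eqP; ring.
rewrite subr_ge0 => sL.
have := Ks _ _ _ sx.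
have : (2 * Lam)^-1 * sqn (gx - gy) <= s * sqn (gx - gy).
  rewrite ler_pM2r // -[leLHS]mul1r ler_pdivrMr ?mulr_gt0 //; lra.
lra.
Qed.

(** The triangle inequality through [g2], squared by means of Young's inequality with weight
    [l * gam]. *)
Lemma lipschitz_step_bound E (l : R) : 0 < l ->
  (forall x1 c1 g1 x2 c2 g2, subgrad_epi E x1 c1 g1 -> subgrad_epi E x2 c2 g2 ->
    sqn (g1 - g2) <= l ^+ 2 * sqn (x1 - x2)) ->
  implicit_step_bound E l 1.
Proof.
move=> l0 H gam x1 c1 g1 x2 c2 g2 g gam0 _ s1 s2 e.
have := H _ _ _ _ _ _ s1 s2; rewrite e sqnZ => h.
have lg0 : 0 < l * gam by rewrite mulr_gt0.
have yo := young (g2 - g) (g1 - g2) lg0.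
have : (l * gam)^-1 * sqn (g1 - g2) <= l * gam * sqn (g2 - g).
  rewrite mulrC ler_pdivrMr //; apply: le_trans h _.
  by rewrite le_eqVlt; apply/orP; left; apply/eqP; ring.
have -> : g1 - g = (g2 - g) + (g1 - g2) by vring.
have -> : sqn ((g2 - g) + (g1 - g2)) =
    sqn (g2 - g) + 2 * dotp (g2 - g) (g1 - g2) + sqn (g1 - g2).
  rewrite /sqn (dotpDl (g2 - g)) !(dotpDr _ (g2 - g)).
  by rewrite (dotpC (g1 - g2) (g2 - g)); ring.
nra.
Qed.

(** The epigraph of f - mu/2 |.|^2 when [E] is that of f. *)
Definition shift_epi (mu : R) E x r := E x (r + mu / 2 * sqn x).

Lemma sqnDE x y : sqn (x + y) = sqn x + 2 * dotp x y + sqn y.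
Proof. by rewrite /sqn !dotpE (dotpC y x); ring. Qed.

Lemma closed_shift_epi mu E : 0 <= mu -> closed_epi E ->
  closed_epi (shift_epi mu E).
Proof.
move=> mu0 clE x r H; apply: clE => e e0.
pose K := 1 + mu / 2 * (sqn x + 2).
have K1 : 1 <= K.
  have : 0 <= mu / 2 * (sqn x + 2).
    by rewrite mulr_ge0 ?addr_ge0 ?sqn_ge0 ?divr_ge0.
  by rewrite /K; lra.
(* This [q] is at most 1 with [q * K < e]; at squared distance below [q ^+ 2] from [x], the height
   and the quadratic together rise by less than [q * K]. *)
pose q := e / (K + e).
have Ke0 : 0 < K + e by lra.
have q0 : 0 < q by rewrite divr_gt0.
have qE : q * (K + e) = e by rewrite /q mulfVK // gt_eqF.
have q1 : q <= 1 by rewrite /q ler_pdivrMr //; lra.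
have qK : q * K < e by have := mulr_gt0 q0 e0; lra.
have qq : q ^+ 2 <= q by rewrite expr2 ler_piMl // ltW.
have qqK : q <= q * K by rewrite ler_peMr // ltW.
have [y [s [Ey yx sr]]] := H (q ^+ 2) (exprn_gt0 2 q0).
exists y, (s + mu / 2 * sqn y); split=> //; first by lra.
have -> : y = x + (y - x) by vring.
rewrite sqnDE.
have yo := young x (y - x) q0.
have : q^-1 * sqn (y - x) <= q.
  by rewrite mulrC ler_pdivrMr // -expr2 ltW.
move=> h.
have : mu / 2 * (sqn x + 2 * dotp x (y - x) + sqn (y - x)) <=
       mu / 2 * (sqn x + q * (sqn x + 2)).
  by apply: ler_wpM2l; [rewrite divr_ge0 | lra].
by move: qK; rewrite /K; lra.
Qed.

(** Along the segment from [x] to [y] the quadratic departs from its linearization only at order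
    [t ^+ 2]; convexity of the shifted function carries the first-order inequality to [y]. *)
Lemma subgrad_shift mu E x c g : convex_epi (shift_epi mu E) ->
  subgrad_epi E x c g ->
  subgrad_epi (shift_epi mu E) x (c - mu / 2 * sqn x) (g - mu *: x).
Proof.
move=> cS [Ex sx].
have Sx : shift_epi mu E x (c - mu / 2 * sqn x) by rewrite /shift_epi subrK.
split=> // y r Sy; rewrite -subr_ge0.
apply: (@linear_coef_ge0 _ _ (mu / 2 * sqn (y - x))) => t t0 t1.
have := sx _ _ (cS _ _ _ _ _ t0 t1 Sy Sx).
have -> : t *: y + (1 - t) *: x = x + t *: (y - x) by vring.
have -> : x + t *: (y - x) - x = t *: (y - x) by vring.
rewrite sqnDE sqnZ !dotpZr (dotpDl g) dotpNl dotpZl.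
lra.
Qed.

Lemma subgrad_unshift mu E x c g : 0 <= mu ->
  subgrad_epi (shift_epi mu E) x c g ->
  subgrad_epi E x (c + mu / 2 * sqn x) (g + mu *: x).
Proof.
move=> mu0 [Sx sx]; split=> // y r Ey.
have := sx y (r - mu / 2 * sqn y); rewrite /shift_epi subrK => /(_ Ey).
have -> : sqn y = sqn x + 2 * dotp x (y - x) + sqn (y - x).
  by rewrite -sqnDE addrC subrK.
rewrite dotpDl dotpZl.
have : 0 <= mu / 2 * sqn (y - x) by rewrite mulr_ge0 ?sqn_ge0 ?divr_ge0.
lra.
Qed.

(** Let [w] be the difference of the unshifted gradients and a = g2 - g, so that g1 - g = (1 - mu
    gam) a + w. Cocoercivity gives |w|^2 <= l gam <w, a>, hence <w, a> <= l gam |a|^2, and the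
    expanded square is at most (1 + (l - mu) gam)^2 |a|^2. *)
Lemma cocoercive_shift_step_bound mu E (l : R) : 0 <= mu -> mu < l ->
  (forall x1 c1 g1 x2 c2 g2, subgrad_epi E x1 c1 g1 -> subgrad_epi E x2 c2 g2 ->
    sqn (g1 - g2) <= l * dotp (g1 - g2) (x1 - x2)) ->
  implicit_step_bound (shift_epi mu E) (l - mu) (mu + 1)^-1.
Proof.
move=> mu0 mul H gam x1 c1 g1 x2 c2 g2 g gam0 gam1 s1 s2 e.
have := H _ _ _ _ _ _ (subgrad_unshift mu0 s1) (subgrad_unshift mu0 s2).
set w := _ + _ - _; rewrite e dotpZr; set a := g2 - g => hw.
(* The step limit keeps the coefficient of the cross term nonnegative. *)
have mg : mu * gam < 1.
  move: gam1; rewrite -[ltRHS]mul1r ltr_pdivlMr; nra.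
have -> : g1 - g = (1 - mu * gam) *: a + w.
  have -> : g1 - g = a + (w - mu *: (x1 - x2)) by rewrite /a /w; vring.
  by rewrite e -/a; vring.
rewrite sqnDE sqnZ dotpZl (dotpC a w).
have lg0 : 0 < l * gam by rewrite mulr_gt0 //; lra.
have wa : dotp w a <= l * gam * sqn a.
  rewrite -(ler_pM2l lg0).
  have := sqn_ge0 (w - (l * gam) *: a).
  rewrite sqnDE sqnN sqnZ dotpNr dotpZr; lra.
have : (2 * (1 - mu * gam) + l * gam) * dotp w a <=
  (2 * (1 - mu * gam) + l * gam) * (l * gam * sqn a).
  by rewrite ler_wpM2l //; lra.
lra.
Qed.

Lemma smooth_strongly_convex_lower_bound mu l E x cx gx y cy gy :
  0 <= mu -> mu < l -> convex_epi E -> closed_epi E ->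
  convex_epi (shift_epi mu E) ->
  (forall x1 c1 g1 x2 c2 g2, subgrad_epi E x1 c1 g1 -> subgrad_epi E x2 c2 g2 ->
    sqn (g1 - g2) <= l ^+ 2 * sqn (x1 - x2)) ->
  subgrad_epi E x cx gx -> subgrad_epi E y cy gy ->
  (cy - mu / 2 * sqn y) + dotp (gy - mu *: y) (x - y)
    + (2 * (l - mu))^-1 * sqn (gx - mu *: x - (gy - mu *: y))
  <= cx - mu / 2 * sqn x.
Proof.
move=> mu0 mul cE clE cS lip sx sy.
have l0 : 0 < l by lra.
have coco x1 c1 g1 x2 c2 g2 : subgrad_epi E x1 c1 g1 -> subgrad_epi E x2 c2 g2 ->
    sqn (g1 - g2) <= l * dotp (g1 - g2) (x1 - x2).
  (* Cocoercivity is the sum of the lower bounds for the pair and for its swap. *)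
  move=> s1 s2; have sb := lipschitz_step_bound l0 lip.
  have := smooth_lower_bound cE clE l0 ltr01 sb s1 s2.
  have := smooth_lower_bound cE clE l0 ltr01 sb s2 s1.
  rewrite (sqnB g2 g1) dotpDl dotpNl.
  have -> : dotp g1 (x2 - x1) = - dotp g1 (x1 - x2) by rewrite -dotpNr opprB.
  rewrite -ler_pdivrMl //.
  have -> : l^-1 = 2 * (2 * l)^-1 by field; rewrite gt_eqF.
  lra.
have g0 : 0 < (mu + 1)^-1 by rewrite invr_gt0; lra.
have lm0 : 0 < l - mu by lra.
apply: (smooth_lower_bound cS (closed_shift_epi mu0 clE) lm0 g0
  (cocoercive_shift_step_bound mu0 mul coco)); exact: subgrad_shift.
Qed.

End SmoothLowerBound.

(** * Interpolating functions *)

Section RealFunctions.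
Variables (R : realType) (d : nat).
Implicit Types (f phi : 'rV[R]_d -> R) (x y g : 'rV[R]_d).

Definition convex_real f := forall x y (t : R), 0 < t -> t < 1 ->
  f (t *: x + (1 - t) *: y) <= t * f x + (1 - t) * f y.

(** Convexity of l/2 |.|^2 - f, expanded: smoothness from above without derivatives. *)
Definition semiconcave (l : R) f := forall x y (t : R), 0 < t -> t < 1 ->
  t * f x + (1 - t) * f y - l / 2 * (t * (1 - t) * sqn (x - y))
    <= f (t *: x + (1 - t) *: y).

Definition lipschitz_real (K : R) f := forall x y, f x <= f y + K * norm2 (x - y).

Lemma sqn_comb x y (t : R) : sqn (t *: x + (1 - t) *: y) =
  t * sqn x + (1 - t) * sqn y - t * (1 - t) * sqn (x - y).
Proof. by rewrite /sqn !dotpE (dotpC y x); ring. Qed.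

Lemma convex_add_sqn mu phi : 0 <= mu -> convex_real phi ->
  convex_real (fun x => phi x + mu / 2 * sqn x).
Proof.
move=> mu0 cphi x y t t0 t1; have := cphi x y t t0 t1; rewrite sqn_comb.
have : 0 <= mu / 2 * (t * (1 - t) * sqn (x - y)).
  by rewrite !mulr_ge0 ?sqn_ge0 //; lra.
lra.
Qed.

Lemma semiconcave_add_sqn l mu phi : semiconcave (l - mu) phi ->
  semiconcave l (fun x => phi x + mu / 2 * sqn x).
Proof.
move=> sphi x y t t0 t1; have := sphi x y t t0 t1; rewrite sqn_comb; lra.
Qed.

(** Semiconcavity is applied to [x] as a combination of [y] and a point [x'] beyond [x]; the
    subgradient bounds [f x'] from below, and [t] tends to 0. *)
Lemma semiconcave_descent l f x g : semiconcave l f ->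
  (forall y, f x + dotp g (y - x) <= f y) ->
  forall y, f y <= f x + dotp g (y - x) + l / 2 * sqn (y - x).
Proof.
move=> sf sx y; rewrite -subr_ge0.
apply: (@linear_coef_ge0 _ _ (f y - f x - dotp g (y - x))) => t t0 t1.
have u0 : 0 < 1 - t by lra.
pose x' := x - (t / (1 - t)) *: (y - x).
have := sf y x' t t0 t1.
have -> : t *: y + (1 - t) *: x' = x.
  by rewrite /x'; apply/rowP => i; rewrite !mxE; field; rewrite gt_eqF.
have -> : y - x' = (1 - t)^-1 *: (y - x).
  by rewrite /x'; apply/rowP => i; rewrite !mxE; field; rewrite gt_eqF.
have := sx x'.
have -> : x' - x = (- (t / (1 - t))) *: (y - x) by rewrite /x'; vring.
rewrite sqnZ dotpZr => h1 h2.
have := ler_wpM2l (ltW u0) h2.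
have -> : (1 - t) * (t * f y + (1 - t) * f x' -
    l / 2 * (t * (1 - t) * ((1 - t)^-1 ^+ 2 * sqn (y - x)))) =
  (1 - t) * t * f y + (1 - t) ^+ 2 * f x' - l / 2 * t * sqn (y - x).
  by field; rewrite gt_eqF.
have h3 := ler_wpM2l (ltW (mulr_gt0 u0 u0)) h1.
move: h3.
have -> : (1 - t) * (1 - t) * (f x + - (t / (1 - t)) * dotp g (y - x)) =
  (1 - t) ^+ 2 * f x - (1 - t) * t * dotp g (y - x).
  by field; rewrite gt_eqF.
rewrite -expr2; lra.
Qed.

(** Adding [half] to its swap gives cocoercivity, which Young's inequality turns into the Lipschitz
    bound. *)
Lemma semiconcave_lipschitz_grad l f x1 g1 x2 g2 : 0 < l -> semiconcave l f ->
  (forall y, f x1 + dotp g1 (y - x1) <= f y) ->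
  (forall y, f x2 + dotp g2 (y - x2) <= f y) ->
  sqn (g1 - g2) <= l ^+ 2 * sqn (x1 - x2).
Proof.
move=> l0 sf.
have half y1 h1 y2 h2 : (forall y, f y1 + dotp h1 (y - y1) <= f y) ->
    (forall y, f y2 + dotp h2 (y - y2) <= f y) ->
    f y2 + dotp h2 (y1 - y2) + (2 * l)^-1 * sqn (h1 - h2) <= f y1.
  move=> s1 s2.
  (* The lower bound from [y2] and the descent bound from [y1] are compared after a gradient step on
     the function tilted by [h2]. *)
  have := s2 (y1 - l^-1 *: (h1 - h2)).
  have := semiconcave_descent sf s1 (y1 - l^-1 *: (h1 - h2)).
  have -> : y1 - l^-1 *: (h1 - h2) - y1 = (- l^-1) *: (h1 - h2) by vring.
  have -> : y1 - l^-1 *: (h1 - h2) - y2 = (y1 - y2) + (- l^-1) *: (h1 - h2).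
    by vring.
  rewrite (dotpDr h2 (y1 - y2)) !dotpZr sqnZ.
  have -> : l / 2 * ((- l^-1) ^+ 2 * sqn (h1 - h2)) = (2 * l)^-1 * sqn (h1 - h2).
    by field; rewrite gt_eqF.
  have -> : dotp h1 (h1 - h2) = sqn (h1 - h2) + dotp h2 (h1 - h2).
    by rewrite /sqn (dotpDl h1) dotpNl; ring.
  have -> : l^-1 = 2 * (2 * l)^-1 by field; rewrite gt_eqF.
  lra.
move=> s1 s2; have := half _ _ _ _ s1 s2; have := half _ _ _ _ s2 s1.
rewrite (sqnB g2 g1).
have -> : dotp g1 (x2 - x1) = - dotp g1 (x1 - x2) by rewrite -dotpNr opprB.
have := young (g1 - g2) (x1 - x2) (_ : 0 < l^-1).
rewrite invr_gt0 invrK (dotpDl g1) dotpNl => /(_ l0).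
have -> : l ^+ 2 * sqn (x1 - x2) = l * (l * sqn (x1 - x2)) by ring.
rewrite -ler_pdivrMl //.
have -> : (2 * l)^-1 = l^-1 / 2 by field; rewrite gt_eqF.
lra.
Qed.

Lemma F_muL_add_sqn mu (L : \bar R) K phi : 0 <= mu -> (mu%:E < L)%E ->
  convex_real phi -> lipschitz_real K phi ->
  (forall l, L = l%:E -> semiconcave (l - mu) phi) ->
  F_muL mu L (fun x => (phi x + mu / 2 * sqn x)%:E).
Proof.
move=> mu0 muL cphi lphi sphi; split.
- by split=> //; exists 0.
- move=> x a; rewrite lte_fin => lt.
  have K0 : 0 < `|K| + mu * norm2 x + 1.
    have := mulr_ge0 mu0 (norm2_ge0 x); have := normr_ge0 K; lra.
  pose gap := phi x + mu / 2 * sqn x - a.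
  (* The divisor is a Lipschitz constant of [phi] plus the slope mu |x| of the quadratic at [x]; the
     1 keeps it positive. *)
  exists (gap / (`|K| + mu * norm2 x + 1)).
    by rewrite divr_gt0 // subr_gt0.
  move=> y; rewrite ltr_pdivlMr // lte_fin /gap => lt2.
  have := lphi x y.
  have -> : norm2 (x - y) = norm2 (y - x) by rewrite /norm2 -!/(sqn _) sqnB.
  have n0 := norm2_ge0 (y - x).
  have Kn : K * norm2 (y - x) <= `|K| * norm2 (y - x) by rewrite ler_wpM2r ?ler_norm.
  have -> : sqn y = sqn x + 2 * dotp x (y - x) + sqn (y - x).
    by rewrite -sqnDE addrC subrK.
  have := dotp_le_norm2 (- x) (y - x).
  have -> : norm2 (- x) = norm2 x by rewrite /norm2 -!/(sqn _) sqnN.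
  rewrite dotpNl => /(ler_wpM2l mu0).
  have : 0 <= mu / 2 * sqn (y - x) by rewrite mulr_ge0 ?sqn_ge0 ?divr_ge0.
  lra.
- move=> x y t t0 t1; rewrite -!EFinM -EFinD lee_fin.
  exact: (convex_add_sqn mu0 cphi).
- move=> x1 x2 g1 g2 [_ s1] [_ s2].
  case: L muL sphi => [l| |] //= muL sphi; last by rewrite mul0r norm2_ge0.
  have l0 : 0 < l by rewrite lte_fin in muL; exact: le_lt_trans muL.
  have := semiconcave_lipschitz_grad l0 (semiconcave_add_sqn (sphi l erefl)) s1 s2.
  rewrite -!norm2_sqr -exprMn ler_sqr ?nnegrE ?mulr_ge0 ?norm2_ge0 ?(ltW l0) //.
  by rewrite ler_pdivrMl.
- move=> x y t t0 t1; rewrite -!EFinB -!EFinM -EFinD lee_fin !norm2_sqr !addrK.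
  exact: cphi.
Qed.

End RealFunctions.

(** * Maxima of affine functions and their Moreau envelopes *)

Section Interpolant.
Variables (R : realType) (d : nat) (I : finType) (i0 : I).
Variables (x g : I -> 'rV[R]_d) (f : I -> R).
Implicit Types (y z : 'rV[R]_d).

(** The term of [i0] starts the maximum. The Moreau envelope lowers an affine piece of slope [g j]
    by |g_j|^2 / (2 Lam), which the offset compensates when k = 1 / (2 Lam). *)
Definition max_affine (k : R) y : R :=
  \big[Num.max/f i0 + dotp (g i0) (y - x i0) + k * sqn (g i0)]_(j : I)
    (f j + dotp (g j) (y - x j) + k * sqn (g j)).

Lemma max_affine_ge k y j :
  f j + dotp (g j) (y - x j) + k * sqn (g j) <= max_affine k y.
Proof. exact: le_bigmax. Qed.

Lemma max_affine_le k y a :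
  (forall j, f j + dotp (g j) (y - x j) + k * sqn (g j) <= a) ->
  max_affine k y <= a.
Proof. by move=> H; apply/bigmax_le => // j _. Qed.

Lemma max_affine_convex k : convex_real (max_affine k).
Proof.
move=> y z t t0 t1; apply: max_affine_le => j.
have u0 : 0 < 1 - t by lra.
have := ler_wpM2l (ltW t0) (max_affine_ge k y j).
have := ler_wpM2l (ltW u0) (max_affine_ge k z j).
rewrite !dotpE; lra.
Qed.

Definition grad_bound : R := \sum_(j : I) norm2 (g j).

Lemma max_affine_lipschitz k : lipschitz_real grad_bound (max_affine k).
Proof.
move=> y z; apply: max_affine_le => j.
have := max_affine_ge k z j.
have -> : y - x j = (z - x j) + (y - z) by vring.
rewrite (dotpDr (g j) (z - x j)).
have : norm2 (g j) * norm2 (y - z) <= grad_bound * norm2 (y - z).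
  rewrite ler_wpM2r ?norm2_ge0 // /grad_bound (bigD1 j) //= lerDl.
  by apply: sumr_ge0 => i _; exact: norm2_ge0.
have := dotp_le_norm2 (g j) (y - z).
lra.
Qed.

Variable Lam : R.
Hypothesis Lam0 : 0 < Lam.

Let h := max_affine (2 * Lam)^-1.

Definition moreau_env z : R :=
  inf [set v | exists y, v = h y + Lam / 2 * sqn (z - y)]%classic.

Lemma affine_le_envelope_arg z y j :
  f j + dotp (g j) (z - x j) <= h y + Lam / 2 * sqn (z - y).
Proof.
have := max_affine_ge (2 * Lam)^-1 y j; rewrite -/h.
have -> : z - x j = (y - x j) + (z - y) by vring.
rewrite (dotpDr (g j) (y - x j)).
have := young (g j) (z - y) (_ : 0 < Lam^-1).
rewrite invr_gt0 invrK => /(_ Lam0).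
have -> : Lam^-1 = 2 * (2 * Lam)^-1 by field; rewrite gt_eqF.
lra.
Qed.

Lemma moreau_env_lb z a :
  (forall y, a <= h y + Lam / 2 * sqn (z - y)) -> a <= moreau_env z.
Proof.
move=> H; apply: lb_le_inf; first by exists (h 0 + Lam / 2 * sqn (z - 0)), 0.
by move=> _ [y ->].
Qed.

Let has_inf_env z :
  has_inf [set v | exists y, v = h y + Lam / 2 * sqn (z - y)]%classic.
Proof.
split; first by exists (h 0 + Lam / 2 * sqn (z - 0)), 0.
by exists (f i0 + dotp (g i0) (z - x i0)) => _ [y ->]; exact: affine_le_envelope_arg.
Qed.

Lemma moreau_env_le z y : moreau_env z <= h y + Lam / 2 * sqn (z - y).
Proof. by apply: ge_inf; [case: (has_inf_env z) | exists y]. Qed.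

Lemma moreau_env_approx z e : 0 < e ->
  exists y, h y + Lam / 2 * sqn (z - y) < moreau_env z + e.
Proof. by move=> e0; have [_ [y ->] lt] := inf_adherent e0 (has_inf_env z); exists y. Qed.

Lemma moreau_env_ge j z : f j + dotp (g j) (z - x j) <= moreau_env z.
Proof. by apply: moreau_env_lb => y; exact: affine_le_envelope_arg. Qed.

(** The minimized expression is jointly convex, so near-minimizers can be combined. *)
Lemma moreau_env_convex : convex_real moreau_env.
Proof.
move=> y z t t0 t1; apply/ler_addgt0Pr => e e0.
have [p lp] := moreau_env_approx y e0; have [q lq] := moreau_env_approx z e0.
apply: le_trans (moreau_env_le _ (t *: p + (1 - t) *: q)) _.
have u0 : 0 < 1 - t by lra.
have := max_affine_convex (2 * Lam)^-1 p q t0 t1; rewrite -/h.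
have -> : t *: y + (1 - t) *: z - (t *: p + (1 - t) *: q) =
  t *: (y - p) + (1 - t) *: (z - q) by vring.
rewrite sqn_comb.
have : 0 <= Lam / 2 * (t * (1 - t) * sqn (y - p - (z - q))).
  by rewrite !mulr_ge0 ?sqn_ge0 ?invr_ge0 ?(ltW Lam0) ?(ltW t0) ?(ltW u0).
have := ler_wpM2l (ltW t0) (ltW lp); have := ler_wpM2l (ltW u0) (ltW lq).
lra.
Qed.

(** An infimum of quadratics in [z] of curvature [Lam], each of which satisfies the inequality with
    equality. *)
Lemma moreau_env_semiconcave : semiconcave Lam moreau_env.
Proof.
move=> y z t t0 t1; apply: moreau_env_lb => p.
have u0 : 0 < 1 - t by lra.
have := ler_wpM2l (ltW t0) (moreau_env_le y p).
have := ler_wpM2l (ltW u0) (moreau_env_le z p).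
have -> : t *: y + (1 - t) *: z - p = t *: (y - p) + (1 - t) *: (z - p) by vring.
have -> : y - z = (y - p) - (z - p) by vring.
rewrite sqn_comb; lra.
Qed.

Lemma moreau_env_lipschitz : lipschitz_real grad_bound moreau_env.
Proof.
move=> y z; apply/ler_addgt0Pr => e e0.
have [p lp] := moreau_env_approx z e0.
apply: le_trans (moreau_env_le _ (p + (y - z))) _.
have -> : y - (p + (y - z)) = z - p by vring.
have := max_affine_lipschitz (2 * Lam)^-1 (p + (y - z)) p; rewrite -/h.
have -> : p + (y - z) - p = y - z by vring.
lra.
Qed.

Lemma moreau_env_interpolates i :
  (forall j, f j + dotp (g j) (x i - x j) + (2 * Lam)^-1 * sqn (g i - g j) <= f i) ->
  moreau_env (x i) = f i.
Proof.
move=> H; apply/eqP; rewrite eq_le; apply/andP; split; last first.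
  have := moreau_env_ge i (x i).
  by have := dotp0l (g i); rewrite dotpC subrr => ->; rewrite addr0.
(* At this proximal point of [x i], the offset of piece [j] completes the square |g_i - g_j|^2 / (2
   Lam), and the hypothesis makes piece [i] the largest. *)
apply: le_trans (moreau_env_le _ (x i - Lam^-1 *: g i)) _.
have -> : x i - (x i - Lam^-1 *: g i) = Lam^-1 *: g i by vring.
suff : h (x i - Lam^-1 *: g i) <= f i - (2 * Lam)^-1 * sqn (g i).
  rewrite sqnZ; have -> : Lam / 2 * (Lam^-1 ^+ 2 * sqn (g i)) =
    (2 * Lam)^-1 * sqn (g i) by field; rewrite gt_eqF.
  lra.
apply: max_affine_le => j; have := H j.
have -> : x i - Lam^-1 *: g i - x j = (x i - x j) + (- Lam^-1) *: g i by vring.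
rewrite (dotpDr (g j) (x i - x j)) dotpZr (sqnDE (g i)) sqnN dotpNr (dotpC (g j) (g i)).
have -> : Lam^-1 = 2 * (2 * Lam)^-1 by field; rewrite gt_eqF.
lra.
Qed.

End Interpolant.

(** * Interpolability as a system of pairwise inequalities *)

Section InterpolationConditions.
Variables (R : realType) (d : nat).
Implicit Types (f : 'rV[R]_d -> \bar R) (x g : 'rV[R]_d) (mu : R) (L : \bar R).

Definition epi f x (r : R) := (f x <= r%:E)%E.

Lemma epi_convex f : convex_fun f -> convex_epi (epi f).
Proof.
move=> cf x y r s t t0 t1 Ex Ey; apply: le_trans (cf x y t t0 t1) _.
rewrite [leRHS]EFinD !EFinM; apply: leeD; apply: lee_wpmul2l => //.
  by rewrite lee_fin ltW.
by rewrite lee_fin subr_ge0 ltW.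
Qed.

Lemma epi_closed f : lsc_fun f -> closed_epi (epi f).
Proof.
move=> lf x r H; rewrite /epi leNgt; apply/negP => lt.
have [a ra ax] : exists2 a, r < a & (a%:E < f x)%E.
  case: (f x) lt => [v| |] //.
    by rewrite lte_fin => rv; exists ((r + v) / 2); rewrite ?lte_fin; lra.
  by move=> _; exists (r + 1); rewrite ?ltry //; lra.
have [e e0 He] := lf _ _ ax.
(* The minimum keeps [y] in the ball of lower semicontinuity and [s] below [a]. *)
have m0 : 0 < Num.min (e ^+ 2) (a - r).
  by rewrite lt_min exprn_gt0 //= subr_gt0.
have [y [s [Ey]]] := H _ m0.
rewrite lt_min => /andP[ye _] sr.
have sa : s < a by move: sr; rewrite -ltrBlDl lt_min => /andP[_]; lra.
have : (a%:E < f y)%E.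
  apply: He; rewrite -ltr_sqr ?nnegrE ?norm2_ge0 ?(ltW e0) //.
  by rewrite norm2_sqr.
move=> /lt_le_trans /(_ Ey); rewrite lte_fin; lra.
Qed.

Lemma epi_shift_convex mu f :
  convex_fun (fun x => f x - (mu / 2 * norm2 x ^+ 2)%:E)%E ->
  convex_epi (shift_epi mu (epi f)).
Proof.
move=> cf.
have E x r : shift_epi mu (epi f) x r <->
    epi (fun x => f x - (mu / 2 * norm2 x ^+ 2)%:E)%E x r.
  by rewrite /shift_epi /epi leeBlDr // -EFinD norm2_sqr.
by move=> x y r s t t0 t1 /E Ex /E Ey; apply/E; exact: (epi_convex cf).
Qed.

Lemma subgrad_to_epi f x g (c : R) : f x = c%:E -> subgrad f x g ->
  subgrad_epi (epi f) x c g.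
Proof.
move=> fx [_ sx]; split; first by rewrite /epi fx.
by move=> y r; move: (sx y); rewrite fx /= /epi => /le_trans h /h; rewrite lee_fin.
Qed.

Lemma subgrad_of_epi f x g (c : R) : proper_fun f ->
  subgrad_epi (epi f) x c g -> subgrad f x g.
Proof.
move=> [fN _] [Ex sx]; move: Ex (fN x); rewrite /epi.
case fx : (f x) => [v| |] //; rewrite lee_fin => vc _.
split=> [|y]; rewrite fx //=.
case fy : (f y) (fN y) => [r| |] // _; last by rewrite leey.
have := sx y r; rewrite /epi fy lexx => /(_ isT) h.
by rewrite lee_fin; lra.
Qed.

(** The left-hand side of the semidefinite constraint for a pair, expressed in points, gradients and
    values; see [trace_Amat]. *)
Definition interp_gap mu L (xi gi : 'rV[R]_d) (fi : R)
    (xj gj : 'rV[R]_d) (fj : R) : R :=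
  fj - fi + (cL mu L * dotp gj (xi - xj) + c1 mu L / 2 * sqn (gi - gj)
    + cmu mu L * dotp gi (xj - xi) + cLmu mu L / 2 * sqn (xi - xj)).

(* Subtracting mu/2 |.|^2 from the function reduces the conditions to mu = 0. *)
Lemma interp_gap_fin mu l xi gi fi xj gj fj : mu < l ->
  interp_gap mu l%:E xi gi fi xj gj fj =
  (fj - mu / 2 * sqn xj) + dotp (gj - mu *: xj) (xi - xj)
    + (2 * (l - mu))^-1 * sqn (gi - mu *: xi - (gj - mu *: xj))
  - (fi - mu / 2 * sqn xi).
Proof.
move=> mul; rewrite /interp_gap /sqn /cL /c1 /cmu /cLmu !dotpE.
rewrite (dotpC gj gi) (dotpC xj xi) (dotpC xi gi) (dotpC xi gj) (dotpC xj gi) (dotpC xj gj).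
by field; rewrite subr_eq0 gt_eqF.
Qed.

Lemma interp_gap_pinfty mu xi gi fi xj gj fj :
  interp_gap mu +oo%E xi gi fi xj gj fj =
  (fj - mu / 2 * sqn xj) + dotp (gj - mu *: xj) (xi - xj)
  - (fi - mu / 2 * sqn xi).
Proof.
rewrite /interp_gap /sqn /cL /c1 /cmu /cLmu !dotpE.
by rewrite (dotpC xj xi); field.
Qed.

Lemma interp_gap_le0 mu L f x1 g1 v1 x2 g2 v2 : 0 <= mu -> (mu%:E < L)%E ->
  F_muL mu L f -> f x1 = v1%:E -> f x2 = v2%:E ->
  subgrad f x1 g1 -> subgrad f x2 g2 ->
  interp_gap mu L x1 g1 v1 x2 g2 v2 <= 0.
Proof.
move=> mu0 muL [pf lf cf lip cS] e1 e2 s1 s2.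
have {}s1 := subgrad_to_epi e1 s1; have {}s2 := subgrad_to_epi e2 s2.
have cE := epi_convex cf; have clE := epi_closed lf.
have {}cS := epi_shift_convex cS.
case: L muL lip => [l| |] // muL lip; last first.
  (* What remains is the subgradient inequality of the shifted function at [x2], tested at [x1]. *)
  rewrite interp_gap_pinfty subr_le0.
  have [_ h] := subgrad_shift cS s2; apply: h; exact: (subgrad_shift cS s1).1.
rewrite lte_fin in muL; rewrite interp_gap_fin // subr_le0.
apply: (smooth_strongly_convex_lower_bound mu0 muL cE clE cS _ s1 s2).
move=> y1 c1 h1 y2 c2 h2 t1 t2.
have l0 : 0 < l by apply: le_lt_trans muL.
have := lip _ _ _ _ (subgrad_of_epi pf t1) (subgrad_of_epi pf t2).
rewrite /= ler_pdivrMl // => h.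
rewrite -!norm2_sqr -exprMn ler_sqr ?nnegrE ?mulr_ge0 ?norm2_ge0 ?(ltW l0) //.
Qed.

Lemma interpolable_gap mu L N (x g : idx N -> 'rV[R]_d) fv :
  0 <= mu -> (mu%:E < L)%E ->
  interpolable mu L x g fv <->
  forall i j, interp_gap mu L (x i) (g i) (fv i) (x j) (g j) (fv j) <= 0.
Proof.
move=> mu0 muL; split.
  move=> [f [Ff H]] i j.
  have [ei si] := H i; have [ej sj] := H j.
  exact: interp_gap_le0 Ff ei ej si sj.
move=> H.
(* Data with the quadratic removed: [phi] interpolates them, and the quadratic is added back. *)
pose ft i := fv i - mu / 2 * sqn (x i); pose gt i := g i - mu *: x i.
suff [phi [K [cphi lphi sphi phix phig]]] : exists phi K,
   [/\ convex_real phi, lipschitz_real K phi,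
       forall l, L = l%:E -> semiconcave (l - mu) phi,
       forall i, phi (x i) = ft i &
       forall i y, ft i + dotp (gt i) (y - x i) <= phi y].
  exists (fun y => (phi y + mu / 2 * sqn y)%:E); split.
    exact: F_muL_add_sqn lphi sphi.
  move=> i; rewrite /subgrad phix /= subrK; split=> //; split=> // y.
  rewrite lee_fin; have := phig i y; rewrite /ft /gt.
  have -> : sqn y = sqn (x i) + 2 * dotp (x i) (y - x i) + sqn (y - x i).
    by rewrite -sqnDE addrC subrK.
  rewrite (dotpDl (g i)) dotpNl dotpZl.
  have : 0 <= mu / 2 * sqn (y - x i) by rewrite mulr_ge0 ?sqn_ge0 ?divr_ge0.
  lra.
case: L muL H => [l| |] // muL H; last first.
  pose h := max_affine None x gt ft 0; exists h, (grad_bound gt).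
  have hge i y : ft i + dotp (gt i) (y - x i) <= h y.
    by have := max_affine_ge None x gt ft 0 y i; rewrite mul0r addr0.
  split=> //; first exact: max_affine_convex.
  - exact: max_affine_lipschitz.
  - move=> i; apply/eqP; rewrite eq_le; apply/andP; split.
      apply: max_affine_le => j; have := H i j.
      by rewrite interp_gap_pinfty /ft /gt; lra.
    by have := hge i (x i); rewrite subrr dotpC dotp0l addr0.
rewrite lte_fin in muL.
have Lam0 : 0 < l - mu by lra.
exists (moreau_env None x gt ft (l - mu)), (grad_bound gt); split.
- exact: moreau_env_convex.
- exact: moreau_env_lipschitz.
- by move=> _ [<-]; exact: moreau_env_semiconcave.
- move=> i; apply: moreau_env_interpolates => // j.
  by have := H i j; rewrite interp_gap_fin // /ft /gt; lra.
- by move=> i y; exact: moreau_env_ge.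
Qed.

End InterpolationConditions.

(** * Gram matrices *)

Section Gram.
Variable R : realType.

Lemma dotp_mulmx d (u v : 'rV[R]_d) : dotp u v = (u *m v^T) 0 0.
Proof. by rewrite mxE; apply: eq_bigr => k _; rewrite mxE. Qed.

(** Cholesky factorization by induction on the size, through the Schur complement of the corner
    entry. *)
Lemma psd_factor n (G : 'M[R]_n) : psd G -> exists P : 'M[R]_n, P^T *m P = G.
Proof.
elim: n G => [|n IH] G; first by exists 0; apply/matrixP; case.
rewrite -[n.+1]/(1 + n)%N in G *; move=> [Gs Gp].
set a := G 0 0; set v := ursubmx G; set B := drsubmx G.
have aE : ulsubmx G = a%:M.
  rewrite [LHS]mx11_scalar !mxE; congr (G _ _)%:M; apply/val_inj => //.
have vE : dlsubmx G = v^T by rewrite /v trmx_ursub Gs.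
have Bs : B^T = B by rewrite /B trmx_drsub Gs.
have GE : G = block_mx a%:M v v^T B by rewrite -aE -vE submxK.
have form s (w : 'rV[R]_n) :
    0 <= s ^+ 2 * a + 2 * s * dotp v w + (w *m B *m w^T) 0 0.
  have := Gp (row_mx s%:M w).
  rewrite {1}GE mul_row_block tr_row_mx mul_row_col tr_scalar_mx.
  rewrite !mulmxDl !mul_scalar_mx !mul_mx_scalar -!scalemxAl.
  rewrite -trace_mx11 !mxtraceD !mxtraceZ mxtrace_scalar !trace_mx11.
  rewrite -!dotp_mulmx (dotpC w v) => h; lra.
have [a0|a0] := eqVneq a 0.
  have v0 : v = 0.
    apply: sqn_eq0; apply/eqP; rewrite eq_le sqn_ge0 andbT leNgt; apply/negP => n0.
    set q := (v *m B *m v^T) 0 0.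
    (* The scalar turns the linear term into -(|q| + 1), which outweighs [q]; so a zero pivot forces
       [v] to vanish. *)
    have := form (- (`|q| + 1) / (2 * sqn v)) v; rewrite a0 mulr0 add0r -/q -/(sqn v).
    have -> : 2 * (- (`|q| + 1) / (2 * sqn v)) * sqn v = - (`|q| + 1).
      by field; rewrite gt_eqF.
    by have := ler_norm q; lra.
  have [|P HP] := IH B.
    by split=> // w; have := form 0 w; rewrite expr0n mul0r mulr0 mul0r !add0r.
  exists (block_mx 0 0 0 P : 'M_(1 + n)).
  rewrite tr_block_mx mulmx_block !trmx0 !mulmx0 !mul0mx !add0r HP GE a0 v0 trmx0.
  by rewrite raddf0.
have {}a0 : 0 < a.
  rewrite lt_def a0; have := form 1 0.
  by rewrite !mul0mx mxE dotpC dotp0l expr1n mul1r mulr0 !addr0.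
have [|P HP] := IH (B - a^-1 *: (v^T *m v)).
  split; first by rewrite linearB linearZ /= trmx_mul trmxK Bs.
  (* This scalar minimizes the form for fixed [w], and the minimum is the Schur complement evaluated
     at [w]. *)
  move=> w; have := form (- dotp v w / a) w.
  rewrite mulmxBr mulmxBl -scalemxAr -scalemxAl mulmxA.
  rewrite -[in X in _ -> X]trace_mx11 linearB /= mxtraceZ !trace_mx11.
  have -> : (w *m v^T *m v *m w^T) 0 0 = dotp v w ^+ 2.
    rewrite -mulmxA [w *m v^T]mx11_scalar -dotp_mulmx mul_scalar_mx mxE -dotp_mulmx.
    by rewrite (dotpC w v).
  move/le_trans; apply; rewrite le_eqVlt; apply/orP; left; apply/eqP.
  by field; rewrite gt_eqF.
pose s := Num.sqrt a.
have s0 : s != 0 by rewrite gt_eqF // sqrtr_gt0.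
have ss : s * s = a by rewrite -expr2 sqr_sqrtr // ltW.
exists (block_mx s%:M (s^-1 *: v) 0 P : 'M_(1 + n)).
rewrite tr_block_mx mulmx_block !trmx0 mul0mx mulmx0 mul0mx !addr0 tr_scalar_mx.
rewrite -scalar_mxM ss mul_scalar_mx scalerA mulfV // scale1r.
rewrite mul_mx_scalar linearZ /= scalerA mulfV // scale1r.
rewrite -scalemxAl -scalemxAr scalerA HP -invfM ss addrCA subrr addr0.
by rewrite -GE.
Qed.

Lemma psd_gram_vectors n d (G : 'M[R]_n) : (n <= d)%N -> psd G ->
  exists p : 'I_n -> 'rV[R]_d, forall i j, dotp (p i) (p j) = G i j.
Proof.
move=> nd /psd_factor[P <-].
(* Column [i] of [P], padded with zeros from index [n] on. *)
pose e (i : 'I_n) (k : nat) : R := if insub k is Some k' then P k' i else 0.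
exists (fun i => \row_(k < d) e i k) => i j.
rewrite mxE /dotp.
under eq_bigr do rewrite !mxE.
rewrite -(big_mkord xpredT (fun k => e i k * e j k)).
rewrite (big_cat_nat (n := n)) //= [X in _ + X]big1_seq ?addr0; last first.
  move=> k; rewrite mem_index_iota => /andP[_ /andP[nk _]].
  by rewrite /e insubF ?mul0r // ltnNge nk.
rewrite big_mkord; apply: eq_bigr => k _.
by rewrite mxE /e valK.
Qed.

Lemma gram_psd m n (P : 'M[R]_(m, n)) : psd (P^T *m P).
Proof.
split; first by rewrite trmx_mul trmxK.
move=> v; rewrite mulmxA -mulmxA -[P *m _]trmxK trmx_mul trmxK -dotp_mulmx.
exact: sqn_ge0.
Qed.

(** Turns the outer products in [Amat] into inner products of points and gradients. *)
Lemma trace_gram_outer m n (P : 'M[R]_(m, n)) (u v : 'cV[R]_n) :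
  \tr (P^T *m P *m (u *m v^T)) = dotp (P *m u)^T (P *m v)^T.
Proof.
by rewrite dotpC dotp_mulmx trmxK trmx_mul -trace_mx11 mulmxA mxtrace_mulC !mulmxA.
Qed.

End Gram.

(** * Runs of the method and feasible Gram matrices *)

Section Realization.
Variables (R : realType) (mu : R) (L : \bar R) (h : nat -> nat -> R) (d N : nat).

Lemma trace_Amat (P : 'M[R]_(d, N.+2)) (i j : idx N) (fi fj : R) :
  fj - fi + \tr (P^T *m P *m Amat mu L h i j) =
  interp_gap mu L (P *m hvec h i)^T (P *m uvec R i)^T fi
                  (P *m hvec h j)^T (P *m uvec R j)^T fj.
Proof.
rewrite /Amat /interp_gap -scalemxAr mxtraceZ !mulmxDr -!scalemxAr !mulmxDr.
rewrite !mxtraceD !mxtraceZ !mxtraceD !trace_gram_outer !mulmxBr !linearB /=.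
set xi := (P *m hvec h i)^T; set xj := (P *m hvec h j)^T.
set gi := (P *m uvec R i)^T; set gj := (P *m uvec R j)^T.
rewrite (dotpC (xi - xj) gj) (dotpC (xj - xi) gi) -!/(sqn _).
by field.
Qed.

Lemma trace_AR (P : 'M[R]_(d, N.+2)) :
  \tr (P^T *m P *m AR R N) = sqn (P *m ebas R ord_max)^T.
Proof. exact: trace_gram_outer. Qed.

Lemma mulmx_ebas (P : 'M[R]_(d, N.+2)) j : P *m ebas R j = col j P.
Proof.
apply/colP => k; rewrite !mxE (bigD1 j) //= mxE eqxx mulr1 big1 ?addr0 // => l lj.
by rewrite mxE (negbTE lj) mulr0.
Qed.

Variables (x g : idx N -> 'rV[R]_d).
Hypotheses (x0 : x None = 0) (g0 : g None = 0).
Hypothesis xE : forall i : 'I_N.+1, (1 <= i)%N ->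
  x (Some i) = x (Some ord0) - \sum_(k < N.+1 | (k < i)%N) h i k *: g (Some k).

Lemma Pmat_uvec i : (Pmat x g *m uvec R i)^T = g i.
Proof.
case: i => [i|] /=; last by rewrite mulmx0 trmx0.
rewrite mulmx_ebas; apply/rowP => k; rewrite !mxE /= ltn_ord.
by congr (g (Some _) _ _); apply/val_inj; rewrite /= inordK.
Qed.

Lemma Pmat_hvec i : (Pmat x g *m hvec h i)^T = x i.
Proof.
case: i => [i|] /=; last by rewrite mulmx0 trmx0.
(* The recursion is assumed from index 1 on; at index 0 its sum is empty. *)
have -> : x (Some i) =
    x (Some ord0) - \sum_(k < N.+1 | (k < i)%N) h i k *: g (Some k).
  have [|i0] := leqP 1 i; first exact: xE.
  have -> : i = ord0 by apply/val_inj/eqP; rewrite -leqn0 -ltnS.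
  by rewrite big_pred0 ?subr0.
apply/rowP => k; rewrite !mxE big_ord_recr /= !mxE /= ltnn mulr1 addrC.
congr (_ + _); rewrite summxE -sumrN [RHS]big_mkcond; apply: eq_bigr => j _.
rewrite !mxE /= ltn_ord.
have -> : inord j = j by apply/val_inj; rewrite /= inordK.
by case: ifP => _; rewrite ?mulr0 // mulrN mulrC.
Qed.

Lemma Pmat_last : (Pmat x g *m ebas R ord_max)^T = x (Some ord0).
Proof. by rewrite mulmx_ebas; apply/rowP => k; rewrite !mxE /= ltnn. Qed.

(** Along a run of the method the matrix constraints are the interpolation inequalities and the
    radius bound, and a Gram matrix is always positive semidefinite; both inclusions of the theorem
    rest on this. *)
Lemma gram_feasible (Rad : R) (f : 'cV[R]_N.+1) (fv : idx N -> R) :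
  0 <= mu -> (mu%:E < L)%E -> 0 <= Rad -> (forall i, fext f i = fv i) ->
  sdp_feasible mu L Rad h (Gram x g) f <->
  interpolable mu L x g fv /\ norm2 (x (Some ord0) - x None) <= Rad.
Proof.
move=> mu0 muL Rad0 fE.
have gapE i j : fext f j - fext f i + \tr (Gram x g *m Amat mu L h i j) =
    interp_gap mu L (x i) (g i) (fv i) (x j) (g j) (fv j).
  by rewrite trace_Amat !Pmat_uvec !Pmat_hvec !fE.
have radE : (\tr (Gram x g *m AR R N) <= Rad ^+ 2) =
    (norm2 (x (Some ord0) - x None) <= Rad).
  rewrite trace_AR Pmat_last x0 subr0 -norm2_sqr ler_sqr ?nnegrE ?norm2_ge0 //.
rewrite interpolable_gap //; split.
  by move=> [H rad _]; rewrite -radE; split=> // i j; rewrite -gapE.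
move=> [H rad]; split; [|by rewrite radE|exact: gram_psd].
by move=> i j; rewrite gapE.
Qed.

End Realization.

Theorem theorem5 (R : realType) (mu : R) (L : \bar R) (N : nat) (Rad : R)
    (h : nat -> nat -> R) (b : 'cV[R]_N.+1) (C : 'M[R]_N.+2) (d : nat) :
  0 <= mu -> (mu%:E < L)%E -> (1 <= N)%N -> 0 <= Rad ->
  lower_tri N h -> C^T = C -> (N.+2 <= d)%N ->
  w_d mu L Rad h b C d = w_sdp mu L Rad h b C.
Proof.
move=> mu0 muL _ Rad0 _ _ Nd; rewrite /w_d /w_sdp; congr ereal_sup.
apply/seteqP; split=> v /=.
  move=> [x [g [fv [[itp [x0 [g0 f0]] xE rad] ->]]]].
  pose f : 'cV[R]_N.+1 := \col_i fv (Some i).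
  have fE i : fext f i = fv i by case: i => [i|] //=; rewrite mxE.
  exists (Gram x g), f; split.
    by apply/(gram_feasible x0 g0 xE mu0 muL Rad0 fE).
  by congr (_ + _)%:E; apply: eq_bigr => i _; rewrite mxE.
move=> [G [f [feas ->]]]; have [_ _ psdG] := feas.
have [p Hp] := psd_gram_vectors Nd psdG.
(* The vectors realizing [G] are read as the gradients, the last one as the starting point; the
   method generates the other iterates, and the Gram matrix is [G] again. *)
pose g (i : idx N) := if i is Some i then p (widen_ord (leqnSn N.+1) i) else 0.
pose x (i : idx N) := if i is Some i then
  p ord_max - \sum_(k < N.+1 | (k < i)%N) h i k *: g (Some k) else 0.
have xord0 : x (Some ord0) = p ord_max by rewrite /x big_pred0 ?subr0.
have PE k j : Pmat x g k j = p j 0 k.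
  rewrite mxE; case: ifPn => [jN|].
    by congr (p _ _ _); apply/val_inj; rewrite /= inordK.
  rewrite xord0 -leqNgt => Nj; congr (p _ _ _); apply/val_inj/eqP.
  by rewrite /= eqn_leq Nj -ltnS ltn_ord.
have GE : Gram x g = G.
  apply/matrixP => i j; rewrite -Hp mxE; apply: eq_bigr => k _.
  by rewrite mxE !PE.
have xE (i : 'I_N.+1) : (1 <= i)%N ->
    x (Some i) = x (Some ord0) - \sum_(k < N.+1 | (k < i)%N) h i k *: g (Some k).
  by rewrite xord0.
rewrite -GE in feas *.
have [itp rad] := (gram_feasible (x := x) (g := g) erefl erefl xE mu0 muL Rad0
  (fun i => erefl (fext f i))).1 feas.
by exists x, g, (fext f); split.
Qed.
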